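(* Let $R$ be a ring and let $\mathcal{I}$ be an ideal of $\operatorname{Hom}_R$ (in the category of left $R$-modules) that is generated by a set of homomorphisms in the extended sense. Then $\mathcal{I}$ is a precovering ideal, i.e. every left $R$-module has an $\mathcal{I}$-precover.
   Context: $R$ is an arbitrary ring; modules are left $R$-modules. An ideal is an additive subfunctor of $\operatorname{Hom}_R$, i.e. a class $\mathcal{I}$ of $R$-homomorphisms such that for all modules $M,N$ the members of $\mathcal I$ from $M$ to $N$ form a subgroup of $\operatorname{Hom}_R(M,N)$, and $f\circ g\circ h\in\mathcal{I}$ whenever $g\in\mathcal{I}$ and $f,h$ are composable homomorphisms. Let $(f_s:M_s\to N_s)_{s\in S}$ be a set of homomorphisms. The ideal $\mathcal{I}$ is generated by $(f_s)_{s\in S}$ in the extended sense if $\mathcal{I}$ consists exactly of the homomorphisms $U\to V$ that have a factorization $$U\longrightarrow \bigoplus_{s\in S}M_s^{(\kappa_s)}\xrightarrow{\ \bigoplus f_s\ }\bigoplus_{s\in S}N_s^{(\kappa_s)}\longrightarrow V$$ for some cardinal numbers $\kappa_s$ ($s\in S$), where $M^{(\kappa)}$ denotes the direct sum of $\kappa$ copies of $M$ and $\bigoplus f_s$ is the direct sum of $\kappa_s$ copies of $f_s$, over all $s\in S$. An $\mathcal{I}$-precover of a module $V$ is a homomorphism $i:A\to V$ in $\mathcal{I}$ such that every homomorphism $i':A'\to V$ in $\mathcal{I}$ factors as $i'=i\circ h$ for some homomorphism $h:A'\to A$. *)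

(* Defs.v *)
From HB Require Import structures.
From mathcomp Require Import all_boot all_order all_algebra.
From mathcomp Require Import boolp classical_sets cardinality.

Set Implicit Arguments.
Unset Strict Implicit.
Unset Printing Implicit Defensive.

Import GRing.Theory.
Local Open Scope ring_scope.
Local Open Scope classical_set_scope.

Section DirectProduct.
Variables (R : pzRingType) (I : Type) (M : I -> lmodType R).

Definition dprod : Type := forall i, M i.

HB.instance Definition _ := gen_eqMixin dprod.
HB.instance Definition _ := gen_choiceMixin dprod.

Definition dprod_zero : dprod := fun i => 0.
Definition dprod_opp (x : dprod) : dprod := fun i => - x i.
Definition dprod_add (x y : dprod) : dprod := fun i => x i + y i.
Definition dprod_scale (a : R) (x : dprod) : dprod := fun i => a *: x i.

Fact dprod_addA : associative dprod_add.
Proof. by move=> x y z; apply: functional_extensionality_dep => i; apply: addrA. Qed.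
Fact dprod_addC : commutative dprod_add.
Proof. by move=> x y; apply: functional_extensionality_dep => i; apply: addrC. Qed.
Fact dprod_add0 : left_id dprod_zero dprod_add.
Proof. by move=> x; apply: functional_extensionality_dep => i; apply: add0r. Qed.
Fact dprod_addN : left_inverse dprod_zero dprod_opp dprod_add.
Proof. by move=> x; apply: functional_extensionality_dep => i; apply: addNr. Qed.

HB.instance Definition _ :=
  GRing.isZmodule.Build dprod dprod_addA dprod_addC dprod_add0 dprod_addN.

Fact dprod_scaleA a b (x : dprod) :
  dprod_scale a (dprod_scale b x) = dprod_scale (a * b) x.
Proof. by apply: functional_extensionality_dep => i; apply: scalerA. Qed.
Fact dprod_scale1 : left_id 1 dprod_scale.
Proof. by move=> x; apply: functional_extensionality_dep => i; apply: scale1r. Qed.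
Fact dprod_scaleDr : right_distributive dprod_scale +%R.
Proof. by move=> a x y; apply: functional_extensionality_dep => i; apply: scalerDr. Qed.
Fact dprod_scaleDl (x : dprod) : {morph dprod_scale^~ x : a b / a + b}.
Proof. by move=> a b; apply: functional_extensionality_dep => i; apply: scalerDl. Qed.

HB.instance Definition _ := GRing.Zmodule_isLmodule.Build R dprod
  dprod_scaleA dprod_scale1 dprod_scaleDr dprod_scaleDl.

Definition finsupp : {pred dprod} :=
  fun x => `[< finite_set [set i | x i <> 0] >].

Fact finsupp_submod_closed : submod_closed finsupp.
Proof.
split=> [|a x y]; rewrite !unfold_in.
  by apply/asboolP; apply: (sub_finite_set _ (@finite_set0 I)) => i /=.
move=> /asboolP fx /asboolP fy; apply/asboolP.
apply: (@sub_finite_set _ _ ([set i | x i <> 0] `|` [set i | y i <> 0])).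
  move=> i /= nz; have [x0|nx0] := pselect (x i = 0); last by left.
  right=> y0; apply: nz.
  by change (a *: x i + y i = 0); rewrite x0 y0 scaler0 addr0.
by rewrite finite_setU.
Qed.

HB.instance Definition _ :=
  GRing.isSubmodClosed.Build R dprod finsupp finsupp_submod_closed.

End DirectProduct.

(* The direct sum of a family of modules indexed by an arbitrary type: the
   submodule of finitely supported elements of the direct product. *)
Record dsum (R : pzRingType) (I : Type) (M : I -> lmodType R) : Type :=
  DSum { dsum_val : dprod M; dsum_valP : dsum_val \in finsupp (M := M) }.

Section DirectSum.
Variables (R : pzRingType) (I : Type) (M : I -> lmodType R).

HB.instance Definition _ := [isSub for @dsum_val R I M].
HB.instance Definition _ := [Choice of dsum M by <:].
HB.instance Definition _ := [SubChoice_isSubLmodule of dsum M by <:].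

End DirectSum.

Section DirectSumMap.
Variables (R : pzRingType) (I : Type) (M N : I -> lmodType R).
Variable f : forall i, {linear M i -> N i}.

Fact dsum_map_subproof (x : dsum M) :
  ((fun i => f i (dsum_val x i)) : dprod N) \in finsupp (M := N).
Proof.
have := dsum_valP x; rewrite !unfold_in => /asboolP fx; apply/asboolP.
by apply: sub_finite_set fx => i /= nz x0; apply: nz; rewrite x0 linear0.
Qed.

Definition dsum_map (x : dsum M) : dsum N := DSum (dsum_map_subproof x).

Fact dsum_map_is_linear : linear dsum_map.
Proof.
move=> a x y; apply: val_inj; apply: functional_extensionality_dep => i.
exact: (linearP (f i)).
Qed.

HB.instance Definition _ :=
  GRing.isLinear.Build R (dsum M) (dsum N) _ dsum_map dsum_map_is_linear.

End DirectSumMap.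

(* Cardinal numbers are represented by arbitrary index types K. *)
Definition copies (R : pzRingType) (K : Type) (M : lmodType R) : lmodType R :=
  dsum (fun _ : K => M).

Definition copies_map (R : pzRingType) (K : Type) (M N : lmodType R)
    (f : {linear M -> N}) : {linear copies K M -> copies K N} :=
  dsum_map (fun _ : K => f).

Definition hom_class (R : pzRingType) :=
  forall M N : lmodType R, {linear M -> N} -> Prop.

Record is_ideal (R : pzRingType) (J : hom_class R) : Prop := IsIdeal {
  ideal0 : forall M N : lmodType R, J M N \0;
  idealB : forall (M N : lmodType R) (f g : {linear M -> N}),
    J M N f -> J M N g -> J M N (f \- g);
  ideal_comp : forall (K L M N : lmodType R)
      (f : {linear M -> N}) (g : {linear L -> M}) (h : {linear K -> L}),
    J L M g -> J K N (f \o g \o h)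
}.

Definition generated_extended (R : pzRingType) (S : Type)
    (M N : S -> lmodType R) (f : forall s, {linear M s -> N s})
    (J : hom_class R) : Prop :=
  forall (U V : lmodType R) (u : {linear U -> V}),
    J U V u <->
    exists (kappa : S -> Type)
           (a : {linear U -> dsum (fun s => copies (kappa s) (M s))})
           (b : {linear dsum (fun s => copies (kappa s) (N s)) -> V}),
      u =1 b \o dsum_map (fun s => copies_map (kappa s) (f s)) \o a.

Definition is_precover (R : pzRingType) (J : hom_class R) (A V : lmodType R)
    (i : {linear A -> V}) : Prop :=
  J A V i /\
  forall (A' : lmodType R) (i' : {linear A' -> V}), J A' V i' ->
    exists h : {linear A' -> A}, i' =1 i \o h.

Definition precovering (R : pzRingType) (J : hom_class R) : Prop :=
  forall V : lmodType R,
    exists (A : lmodType R) (i : {linear A -> V}), is_precover J i.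

(* Main.v *)
Require Import Defs.
From mathcomp Require Import all_boot all_order all_algebra.
From HB Require Import structures.
From mathcomp Require Import finmap boolp classical_sets cardinality fsbigop.

(** Fix a module V.  A homomorphism into V lies in the ideal when it factors
    through a direct sum of copies of the generators f_s, followed by a map b
    from the direct sum of copies of the N_s to V.  By the universal property
    of direct sums, b is nothing but a choice, for every s and every copy k, of
    a homomorphism b_(s,k) : N_s -> V.  The possible values of b_(s,k) form a
    set, so one copy of f_s for each homomorphism phi : N_s -> V is enough:
    let A be the direct sum over s of Hom(N_s, V)-many copies of M_s, and send
    A to V by the f_s followed by the map that is phi on the copy of N_s
    labelled phi.  This map is in the ideal by construction.  An arbitrary
    factorization, with label sets kappa_s, is carried into A by sending the
    copy k of M_s identically to the copy labelled b_(s,k); several copies may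
    land in the same one, and their entries are then added up.

    The argument rests on the universal property of direct sums over an
    arbitrary index type: [dsum_desc_inj] gives the existence of the map with
    prescribed components and [dsum_ext] its uniqueness. *)

Set Implicit Arguments.
Unset Strict Implicit.
Unset Printing Implicit Defensive.

Import GRing.Theory.
Local Open Scope ring_scope.
Local Open Scope classical_set_scope.

(** * The universal property of direct sums *)

Section DirectSumInjection.
Variables (R : pzRingType) (I : Type) (M : I -> lmodType R).

(** The index type has no decidable equality and the summands depend on the
    index, so the entry at [j] is obtained by transport along a proof of
    [i = j] whenever there is one. *)
Definition dsum_inj_fun (i : I) (m : M i) : dprod M :=
  fun j => if pselect (i = j) is left e then eq_rect i M m j e else 0.

Lemma dsum_inj_fun_id i (m : M i) : dsum_inj_fun m i = m.
Proof.
by rewrite /dsum_inj_fun; case: pselect => // e; rewrite (Prop_irrelevance e erefl).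
Qed.

Lemma dsum_inj_fun_neq i j (m : M i) : i <> j -> dsum_inj_fun m j = 0.
Proof. by rewrite /dsum_inj_fun; case: pselect. Qed.

Fact dsum_inj_subproof i (m : M i) : dsum_inj_fun m \in Defs.finsupp (M := M).
Proof.
rewrite unfold_in; apply/asboolP.
apply: (@sub_finite_set _ _ [set i]); last exact: finite_set1.
move=> j /= nz; have [->//|ne] := pselect (j = i).
by case: nz; apply: dsum_inj_fun_neq => e; apply: ne.
Qed.

Definition dsum_inj i (m : M i) : dsum M := DSum (dsum_inj_subproof m).

Fact dsum_inj_is_linear i : linear (@dsum_inj i).
Proof.
move=> a x y; apply: val_inj; apply: functional_extensionality_dep => j /=.
change (dsum_inj_fun (a *: x + y) j
  = a *: dsum_inj_fun x j + dsum_inj_fun y j).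
have [<-|ne] := pselect (i = j); first by rewrite !dsum_inj_fun_id.
by rewrite !(dsum_inj_fun_neq _ ne) scaler0 addr0.
Qed.

HB.instance Definition _ i :=
  GRing.isLinear.Build R (M i) (dsum M) _ (@dsum_inj i) (@dsum_inj_is_linear i).

Definition dsum_proj j (x : dsum M) : M j := dsum_val x j.

Fact dsum_proj_is_linear j : linear (@dsum_proj j).
Proof. by []. Qed.

HB.instance Definition _ j :=
  GRing.isLinear.Build R (dsum M) (M j) _ (@dsum_proj j) (@dsum_proj_is_linear j).

Lemma dsum_proj_inj i (m : M i) : dsum_proj i (dsum_inj m) = m.
Proof. exact: dsum_inj_fun_id. Qed.

Lemma dsum_proj_inj_neq i j (m : M i) : i <> j -> dsum_proj j (dsum_inj m) = 0.
Proof. exact: dsum_inj_fun_neq. Qed.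

Lemma dsum_eqP (x y : dsum M) : (forall i, dsum_proj i x = dsum_proj i y) -> x = y.
Proof. by move=> e; apply: val_inj; apply: functional_extensionality_dep. Qed.

Definition dsum_supp (x : dsum M) : set {classic I} := [set i | dsum_proj i x <> 0].

Lemma finite_dsum_supp x : finite_set (dsum_supp x).
Proof. by have := dsum_valP x; rewrite unfold_in => /asboolP. Qed.

End DirectSumInjection.

#[local] Arguments dsum_proj {R I M} j x : simpl never.
#[local] Arguments dsum_inj {R I M i} m : simpl never.

Section UniversalProperty.
Variables (R : pzRingType) (I : Type) (M : I -> lmodType R) (V : lmodType R).

Section Descent.
Variable g : forall i, {linear M i -> V}.

Definition dsum_desc (x : dsum M) : V :=
  \sum_(i \in [set: {classic I}]) g i (dsum_proj i x).

(** The supports of several elements differ; this computes the descended map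
    on all of them as a sum over one common finite set of indices. *)
Lemma dsum_descE (X : {fset {classic I}}) (x : dsum M) :
  dsum_supp x `<=` [set` X] -> dsum_desc x = \sum_(i <- X) g i (dsum_proj i x).
Proof.
move=> sX; rewrite /dsum_desc -(@fsbig_widen _ _ _ _ [set` X]) ?fsbig_finite //=.
  by rewrite set_fsetK.
move=> i [_ /= nX]; suff -> : dsum_proj i x = 0 by rewrite linear0.
by apply: contrapT => nz; apply: nX; apply: sX.
Qed.

Fact dsum_desc_is_linear : linear dsum_desc.
Proof.
move=> a x y.
have fin : finite_set (dsum_supp x `|` dsum_supp y).
  by rewrite finite_setU; split; apply: finite_dsum_supp.
have [X eX] := finite_fsetP.1 fin.
rewrite !(@dsum_descE X) -?eX; first last.
- move=> i /= nz; have [x0|] := pselect (dsum_proj i x = 0); last by left.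
  by right=> y0; apply: nz; rewrite linearP /= x0 y0 scaler0 addr0.
- by move=> i; left.
- by move=> i; right.
by rewrite scaler_sumr -big_split; apply: eq_bigr => i _; rewrite !linearP.
Qed.

HB.instance Definition _ :=
  GRing.isLinear.Build R (dsum M) V _ dsum_desc dsum_desc_is_linear.

Lemma dsum_desc_inj i (m : M i) : dsum_desc (dsum_inj m) = g i m.
Proof.
rewrite (@dsum_descE [fset (i : {classic I})]%fset).
  by rewrite big_seq_fset1 dsum_proj_inj.
move=> j /= nz; rewrite inE; apply/eqP; apply: contrapT => ne.
by apply: nz; apply: dsum_proj_inj_neq => e; apply: ne.
Qed.

End Descent.

End UniversalProperty.

Section Generation.
Variables (R : pzRingType) (I : Type) (M : I -> lmodType R).

Lemma dsum_desc_injK (x : dsum M) :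
  dsum_desc (fun i => @dsum_inj R I M i : {linear _ -> _}) x = x.
Proof.
have [X eX] := finite_fsetP.1 (finite_dsum_supp x).
rewrite (@dsum_descE _ _ _ _ _ X) -?eX //; apply: dsum_eqP => j.
rewrite raddf_sum /=.
have [jX|jX] := boolP ((j : {classic I}) \in X).
  rewrite (big_fsetD1 (j : {classic I})) //= dsum_proj_inj.
  rewrite big_seq big1 ?addr0 // => i; rewrite !inE => /andP[/eqP ne _].
  exact: dsum_proj_inj_neq.
have -> : dsum_proj j x = 0.
  apply: contrapT => nz; have : dsum_supp x j by [].
  by rewrite eX /= (negbTE jX).
rewrite big_seq big1 // => i iX; apply: dsum_proj_inj_neq => e.
by move: jX; rewrite -e iX.
Qed.

(** Every element is a finite sum of its entries, so the images of the
    injections generate the direct sum. *)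
Lemma dsum_ext (V : lmodType R) (g h : {linear dsum M -> V}) :
  (forall i (m : M i), g (dsum_inj m) = h (dsum_inj m)) -> g =1 h.
Proof.
move=> e x; rewrite -(dsum_desc_injK x).
have [X eX] := finite_fsetP.1 (finite_dsum_supp x).
rewrite (@dsum_descE _ _ _ _ _ X) -?eX // !raddf_sum.
by apply: eq_bigr => i _; apply: e.
Qed.

End Generation.

Lemma dsum_map_inj (R : pzRingType) (I : Type) (M N : I -> lmodType R)
    (f : forall i, {linear M i -> N i}) i (m : M i) :
  dsum_map f (dsum_inj m) = dsum_inj (f i m).
Proof.
apply: dsum_eqP => j; change (f j (dsum_proj j (dsum_inj m))
  = dsum_proj j (dsum_inj (f i m))).
have [<-|ne] := pselect (i = j); first by rewrite !dsum_proj_inj.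
by rewrite !dsum_proj_inj_neq // linear0.
Qed.

(** * The precover *)

Section Precover.
Variables (R : pzRingType) (S : Type) (M N : S -> lmodType R).
Variables (f : forall s, {linear M s -> N s}) (V : lmodType R).

Definition copies_reindex (K L : Type) (c : K -> L) (P : lmodType R) :
    {linear copies K P -> copies L P} :=
  dsum_desc (fun k => @dsum_inj R L (fun=> P) (c k) : {linear _ -> _}).

Definition hom_eval (s : S) : {linear copies {linear N s -> V} (N s) -> V} :=
  dsum_desc (fun phi : {linear N s -> V} => phi).

Definition precover_dom : lmodType R :=
  dsum (fun s => copies {linear N s -> V} (M s)).

Definition precover_map : {linear precover_dom -> V} :=
  dsum_desc hom_eval \o dsum_map (fun s => copies_map {linear N s -> V} (f s)).

Section Comparison.
Variables (kappa : S -> Type).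
Variable b : {linear dsum (fun s => copies (kappa s) (N s)) -> V}.

Definition component (s : S) (k : kappa s) : {linear N s -> V} :=
  b \o @dsum_inj R S (fun s => copies (kappa s) (N s)) s
    \o @dsum_inj R (kappa s) (fun=> N s) k.

Definition precover_comparison :
    {linear dsum (fun s => copies (kappa s) (M s)) -> precover_dom} :=
  dsum_map (fun s => copies_reindex (@component s) (M s)).

(** Maps out of a direct sum are compared on the generators: on an element [m]
    of the copy [k] of [M s], both sides take the value
    [component s k (f s m)], because relabelling the copy [k] as [component k]
    is exactly what [hom_eval] undoes. *)
Lemma precover_comparisonE :
  precover_map \o precover_comparison
    =1 b \o dsum_map (fun s => copies_map (kappa s) (f s)).
Proof.
apply: dsum_ext => s x /=; rewrite !dsum_map_inj dsum_desc_inj.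
(* Within the summand of index s, the same argument applies to the copies. *)
move: x; apply: (@dsum_ext R (kappa s) (fun=> M s) V
  (hom_eval s \o copies_map _ (f s) \o copies_reindex (@component s) (M s))
  (b \o @dsum_inj R S (fun s => copies (kappa s) (N s)) s
     \o copies_map _ (f s))) => k m /=.
by rewrite dsum_desc_inj !dsum_map_inj dsum_desc_inj.
Qed.

End Comparison.
End Precover.

Theorem corollary6p3 (R : pzRingType) (J : hom_class R) (hJ : is_ideal J)
    (hgen : exists (S : Type) (M N : S -> lmodType R)
                   (f : forall s, {linear M s -> N s}),
        generated_extended f J) :
  precovering J.
Proof.
case: hgen => S [M [N [f gen]]] V.
exists (precover_dom M N V), (precover_map f V); split.
  apply/gen; exists (fun s => {linear N s -> V}), idfun.
  by exists (dsum_desc (@hom_eval _ _ N V)).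
move=> A' i' /gen [kappa [a [b e]]].
exists (precover_comparison M b \o a) => x.
by rewrite e /=; symmetry; apply: (precover_comparisonE f b (a x)).
Qed.
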